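(* Let $f$ be the probability density function of the RTGLE$(\alpha,\beta,\gamma,p)$ distribution, i.e. $$f(x)=\gamma(\alpha+\beta x)\left(\alpha x+\frac{\beta x^{2}}{2}\right)^{\gamma-1}\left[1-p+p\left(\alpha x+\frac{\beta x^{2}}{2}\right)^{\gamma}\right]e^{-\left(\alpha x+\frac{\beta x^{2}}{2}\right)^{\gamma}},\quad x>0,$$ where $\alpha\ge 0$, $\beta\ge 0$, $(\alpha,\beta)\neq(0,0)$, $\gamma>0$ and $p\in[0,1]$. Then $f$ is unimodal if $\gamma\ge 1$, and $f$ is monotonically decreasing on $(0,\infty)$ if $0<\gamma<0.5$ and $\beta=0$.
   Context: The record-based transmuted generalized linear exponential distribution RTGLE$(\alpha,\beta,\gamma,p)$, with parameters $\alpha\ge 0$, $\beta\ge 0$ (not both zero), $\gamma>0$, $p\in[0,1]$, is the distribution on $(0,\infty)$ with distribution function $$F(x)=1-\left[1+p\left(\alpha x+\frac{\beta x^{2}}{2}\right)^{\gamma}\right]e^{-\left(\alpha x+\frac{\beta x^{2}}{2}\right)^{\gamma}},\quad x>0,$$ and $f=F'$ is its density. A density $f$ on $(0,\infty)$ is called unimodal if there is $m\in[0,\infty)$ such that $f$ is nondecreasing on $(0,m)$ and nonincreasing on $(m,\infty)$ (the mode may be at the boundary point $0$). *)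

(* Defs.v *)
From Stdlib Require Import Reals.
From Coquelicot Require Import Coquelicot.

Open Scope R_scope.

Definition rtgle_arg (alpha beta x : R) : R := alpha * x + beta * x ^ 2 / 2.

(* Extended by 0 to x <= 0, since the distribution is carried by (0, oo).
   [Rpower] is the usual real power only at a positive base; the base is
   positive here as x > 0 and alpha, beta >= 0 are not both 0. *)
Definition rtgle_cdf (alpha beta gamma p x : R) : R :=
  if Rlt_dec 0 x then
    1 - (1 + p * Rpower (rtgle_arg alpha beta x) gamma)
        * exp (- Rpower (rtgle_arg alpha beta x) gamma)
  else 0.

(* [Derive] is total, so this is meaningful only where the distribution
   function is differentiable. *)
Definition rtgle_pdf (alpha beta gamma p x : R) : R :=
  Derive (rtgle_cdf alpha beta gamma p) x.

(* The mode m may be the boundary point 0, in which case the first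
   monotonicity condition is vacuous. *)
Definition unimodal (f : R -> R) : Prop :=
  exists m : R, 0 <= m /\
    (forall x y : R, 0 < x -> x <= y -> y < m -> f x <= f y) /\
    (forall x y : R, m < x -> x <= y -> f y <= f x).

Definition decreasing_on_pos (f : R -> R) : Prop :=
  forall x y : R, 0 < x -> x < y -> f y < f x.

(* Main.v *)
(** Put u = alpha x + beta x^2 / 2, so u' = alpha + beta x, and z = u^gamma,
    w = u^(gamma-1), so z = u w.  Differentiating ln f gives
      f' = f u' w H,
      H = beta / (w u'^2) + (gamma - 1) / z + p gamma / (1 - p + p z) - gamma.
    If gamma >= 1, then w, u' and z are nondecreasing in x, so H is
    nonincreasing, and f is unimodal with mode sup {H >= 0}; this is finite
    because H < 0 once z >= 2.  If beta = 0 and gamma < 1/2, then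
    p gamma / (1 - p + p z) <= gamma / z gives
    H <= (2 gamma - 1) / z - gamma < 0 everywhere. *)

Require Import Defs.
From Stdlib Require Import Reals Lra.
From Coquelicot Require Import Coquelicot.

Open Scope R_scope.

(** * Real powers, mean values and monotonicity from the sign of a derivative *)

Lemma Rpower_pos (a b : R) : 0 < Rpower a b.
Proof. apply exp_pos. Qed.

Lemma Rpower_pred (a b : R) : 0 < a -> Rpower a b = a * Rpower a (b - 1).
Proof.
  intros ha; rewrite <- (Rpower_1 a) at 2 by easy.
  rewrite <- Rpower_plus; f_equal; ring.
Qed.

Lemma is_derive_Rpower (u : R -> R) (x du a : R) :
  0 < u x -> is_derive u x du ->
  is_derive (fun t => Rpower (u t) a) x (a * du * Rpower (u x) (a - 1)).
Proof.
  intros hu hd; unfold Rpower.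
  auto_derive; [split; [now exists du | easy] |].
  replace (Derive (fun t => u t) x) with du
    by (symmetry; apply is_derive_unique; exact hd).
  replace ((a - 1) * ln (u x)) with (a * ln (u x) + - ln (u x)) by ring.
  rewrite exp_plus, exp_Ropp, exp_ln by easy; field; lra.
Qed.

Lemma is_derive_pos_MVT (f df : R -> R) (x y : R) :
  (forall t, 0 < t -> is_derive f t (df t)) -> 0 < x -> x <= y ->
  exists c, x <= c <= y /\ f y - f x = df c * (y - x).
Proof.
  intros hd hx hxy.
  destruct (MVT_gen f x y df) as [c [hc e]].
  - intros t ht; rewrite Rmin_left in ht by easy; apply hd; lra.
  - intros t ht; rewrite Rmin_left in ht by easy.
    apply derivable_continuous_pt; exists (df t).
    apply is_derive_Reals, hd; lra.
  - rewrite Rmin_left, Rmax_right in hc by easy; now exists c.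
Qed.

(** The sign of the derivative is that of [h], and an antitone [h] passes from nonnegative to
    negative at most once; the mode is the point where it does. *)
Lemma unimodal_of_derive (f c h : R -> R) (X : R) :
  (forall x, 0 < x -> is_derive f x (c x * h x)) ->
  (forall x, 0 < x -> 0 <= c x) ->
  (forall x y, 0 < x -> x <= y -> h y <= h x) ->
  0 < X -> h X < 0 ->
  unimodal f.
Proof.
  intros hd hc hh hX hneg.
  (* Adjoining 0 keeps [E] nonempty and its supremum nonnegative; if [h] is negative on the whole
     half-line, the mode is 0. *)
  set (E := fun x => x = 0 \/ (0 < x /\ 0 <= h x)).
  destruct (completeness E) as [m [hub hlub]].
  - exists X; intros x [-> | [hx hhx]]; [lra |].
    destruct (Rle_lt_dec x X) as [h1 | h1]; [easy |].
    specialize (hh X x hX (Rlt_le _ _ h1)); lra.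
  - now exists 0; left.
  - assert (hm : 0 <= m) by now apply hub; left.
    exists m; split; [easy | split].
    + intros x y hx hxy hym.
      (* If [h y] were negative, [h] would stay negative beyond [y], so [y] would bound [E] and
         [m <= y]. *)
      assert (hy : 0 <= h y).
      { destruct (Rle_lt_dec 0 (h y)) as [h1 | h1]; [easy |].
        assert (m <= y); [| lra].
        apply hlub; intros s [-> | [hs hhs]]; [lra |].
        destruct (Rle_lt_dec s y) as [h2 | h2]; [easy |].
        assert (h s <= h y) by (apply hh; lra); lra. }
      destruct (is_derive_pos_MVT _ _ x y hd hx hxy) as [t [ht e]].
      assert (h y <= h t) by (apply hh; lra).
      assert (0 <= c t * h t)
        by (apply Rmult_le_pos; [apply hc |]; lra).
      assert (0 <= c t * h t * (y - x)) by (apply Rmult_le_pos; lra); lra.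
    + intros x y hmx hxy.
      assert (hx : 0 < x) by lra.
      destruct (is_derive_pos_MVT _ _ x y hd hx hxy) as [t [ht e]].
      assert (h t <= 0).
      { destruct (Rle_lt_dec (h t) 0) as [h1 | h1]; [easy |].
        assert (t <= m); [apply hub; right |]; lra. }
      assert (0 <= c t * - h t)
        by (apply Rmult_le_pos; [apply hc |]; lra).
      assert (0 <= c t * - h t * (y - x)) by (apply Rmult_le_pos; lra); lra.
Qed.

Lemma decreasing_on_pos_of_derive (f c h : R -> R) :
  (forall x, 0 < x -> is_derive f x (c x * h x)) ->
  (forall x, 0 < x -> 0 < c x) ->
  (forall x, 0 < x -> h x < 0) ->
  decreasing_on_pos f.
Proof.
  intros hd hc hh x y hx hxy.
  destruct (is_derive_pos_MVT _ _ x y hd hx (Rlt_le _ _ hxy)) as [t [ht e]].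
  assert (0 < c t * - h t * (y - x)); [| lra].
  apply Rmult_lt_0_compat; [| lra].
  apply Rmult_lt_0_compat; [apply hc; lra |].
  assert (h t < 0) by (apply hh; lra); lra.
Qed.

Lemma is_derive_ext_pos (f g : R -> R) (x d : R) :
  (forall t, 0 < t -> f t = g t) -> 0 < x ->
  is_derive f x d -> is_derive g x d.
Proof.
  intros hfg hx; apply is_derive_ext_loc.
  (* The ball of radius [x] about [x] contains only positive points. *)
  exists (mkposreal x hx); intros t ht; apply hfg.
  unfold ball in ht; simpl in ht; unfold AbsRing_ball, abs, minus, plus, opp in ht.
  simpl in ht; apply Rabs_def2 in ht; lra.
Qed.

(** * The closed form of the density and its factored derivative *)

Definition rtgle_density (alpha beta gamma p x : R) : R :=
  gamma * (alpha + beta * x)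
  * Rpower (rtgle_arg alpha beta x) (gamma - 1)
  * (1 - p + p * Rpower (rtgle_arg alpha beta x) gamma)
  * exp (- Rpower (rtgle_arg alpha beta x) gamma).

(** The positive factor f u' w of f', which leaves the sign to H. *)
Definition rtgle_weight (alpha beta gamma p x : R) : R :=
  rtgle_density alpha beta gamma p x * (alpha + beta * x)
  * Rpower (rtgle_arg alpha beta x) (gamma - 1).

(** The factor H, that is (ln f)' divided by u' w. *)
Definition rtgle_slope (alpha beta gamma p x : R) : R :=
  beta / (Rpower (rtgle_arg alpha beta x) (gamma - 1) * (alpha + beta * x) ^ 2)
  + (gamma - 1) / Rpower (rtgle_arg alpha beta x) gamma
  + p * gamma / (1 - p + p * Rpower (rtgle_arg alpha beta x) gamma) - gamma.

Section RTGLE.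

Variables alpha beta gamma p : R.
Hypothesis halpha : 0 <= alpha.
Hypothesis hbeta : 0 <= beta.
Hypothesis hab : (alpha, beta) <> (0, 0).
Hypothesis hgamma : 0 < gamma.
Hypothesis hp : 0 <= p <= 1.

Local Notation u x := (rtgle_arg alpha beta x).

Lemma alpha_or_beta_pos : 0 < alpha \/ 0 < beta.
Proof.
  destruct halpha as [h | h]; [now left | right].
  destruct hbeta as [h' | h']; [easy |].
  now destruct hab; rewrite <- h, <- h'.
Qed.

Lemma rtgle_arg_derive_pos (x : R) : 0 < x -> 0 < alpha + beta * x.
Proof.
  intros hx; assert (0 <= beta * x) by (apply Rmult_le_pos; lra).
  destruct alpha_or_beta_pos as [h | h]; [lra |].
  assert (0 < beta * x) by now apply Rmult_lt_0_compat.
  lra.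
Qed.

Lemma rtgle_arg_pos (x : R) : 0 < x -> 0 < u x.
Proof.
  intros hx; pose proof (rtgle_arg_derive_pos x hx).
  unfold rtgle_arg.
  (* u is [x] times the mean of [alpha] and u'. *)
  replace (alpha * x + beta * x ^ 2 / 2)
    with (x * ((alpha + (alpha + beta * x)) / 2)) by field.
  apply Rmult_lt_0_compat; lra.
Qed.

Lemma rtgle_arg_le (x y : R) : 0 < x -> x <= y -> u x <= u y.
Proof.
  intros hx hxy; unfold rtgle_arg.
  assert (x ^ 2 <= y ^ 2) by (apply pow_incr; lra).
  assert (alpha * x <= alpha * y) by now apply Rmult_le_compat_l.
  assert (beta * x ^ 2 <= beta * y ^ 2) by now apply Rmult_le_compat_l.
  lra.
Qed.

Lemma mixture_pos (z : R) : 0 < z -> 0 < 1 - p + p * z.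
Proof.
  (* Either [1 - p] or [p * z] is strictly positive, which covers the endpoints [p = 0] and
     [p = 1]. *)
  intros hz; destruct (Rle_lt_dec p (1 / 2)) as [h | h].
  - assert (0 <= p * z) by (apply Rmult_le_pos; lra); lra.
  - assert (0 < p * z) by (apply Rmult_lt_0_compat; lra); lra.
Qed.

Lemma is_derive_rtgle_arg (x : R) :
  is_derive (rtgle_arg alpha beta) x (alpha + beta * x).
Proof. unfold rtgle_arg; auto_derive; [easy | field]. Qed.

Lemma is_derive_rtgle_cdf (x : R) :
  0 < x ->
  is_derive (rtgle_cdf alpha beta gamma p) x
    (rtgle_density alpha beta gamma p x).
Proof.
  intros hx.
  apply (is_derive_ext_pos
    (fun t => 1 - (1 + p * Rpower (u t) gamma) * exp (- Rpower (u t) gamma)));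
    [intros t ht; unfold rtgle_cdf; now destruct (Rlt_dec 0 t) | easy |].
  pose proof (is_derive_Rpower _ x _ gamma (rtgle_arg_pos x hx)
    (is_derive_rtgle_arg x)) as hz.
  unfold rtgle_density.
  set (z := fun t => Rpower (u t) gamma) in *.
  change (is_derive (fun t => 1 - (1 + p * z t) * exp (- z t)) x
    (gamma * (alpha + beta * x) * Rpower (u x) (gamma - 1)
      * (1 - p + p * z x) * exp (- z x))).
  auto_derive; [repeat split; eexists; exact hz |].
  replace (Derive (fun t => z t) x) with
    (gamma * (alpha + beta * x) * Rpower (u x) (gamma - 1))
    by (symmetry; apply is_derive_unique; exact hz).
  ring.
Qed.

Lemma rtgle_pdfE (x : R) :
  0 < x -> rtgle_pdf alpha beta gamma p x = rtgle_density alpha beta gamma p x.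
Proof. intros hx; now apply is_derive_unique, is_derive_rtgle_cdf. Qed.

Lemma is_derive_rtgle_density (x : R) :
  0 < x ->
  is_derive (rtgle_density alpha beta gamma p) x
    (rtgle_weight alpha beta gamma p x * rtgle_slope alpha beta gamma p x).
Proof.
  intros hx.
  pose proof (rtgle_arg_pos x hx) as hu.
  pose proof (rtgle_arg_derive_pos x hx) as hdu.
  pose proof (is_derive_Rpower _ x _ gamma hu (is_derive_rtgle_arg x)) as hz.
  pose proof (is_derive_Rpower _ x _ (gamma - 1) hu (is_derive_rtgle_arg x))
    as hw.
  assert (ez : Rpower (u x) gamma = u x * Rpower (u x) (gamma - 1))
    by now apply Rpower_pred.
  assert (ew : Rpower (u x) (gamma - 1)
               = u x * Rpower (u x) (gamma - 1 - 1))
    by now apply Rpower_pred.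
  pose proof (mixture_pos _ (Rpower_pos (u x) gamma)) as hq.
  pose proof (Rpower_pos (u x) (gamma - 1)) as hwpos.
  unfold rtgle_weight, rtgle_slope, rtgle_density.
  (* Named as functions, both powers are opaque to [auto_derive], and their derivatives are supplied
     from [hz] and [hw]. *)
  set (z := fun t => Rpower (u t) gamma) in *.
  set (w := fun t => Rpower (u t) (gamma - 1)) in *.
  change (Rpower (u x) gamma) with (z x) in *.
  change (Rpower (u x) (gamma - 1)) with (w x) in *.
  change (is_derive (fun t => gamma * (alpha + beta * t) * w t
    * (1 - p + p * z t) * exp (- z t)) x
    (gamma * (alpha + beta * x) * w x * (1 - p + p * z x) * exp (- z x)
     * (alpha + beta * x) * w x
     * (beta / (w x * (alpha + beta * x) ^ 2) + (gamma - 1) / z x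
        + p * gamma / (1 - p + p * z x) - gamma))).
  auto_derive; [repeat split; eexists; eassumption |].
  replace (Derive (fun t => z t) x) with
    (gamma * (alpha + beta * x) * w x)
    by (symmetry; apply is_derive_unique; exact hz).
  (* Writing u^(gamma-2) as w / u leaves, after z = u w, a rational identity in u, w and the
     parameters, which [field] settles. *)
  replace (Derive (fun t => w t) x) with
    ((gamma - 1) * (alpha + beta * x) * (w x / u x)).
  2: { symmetry; apply is_derive_unique.
       replace (w x / u x) with (Rpower (u x) (gamma - 1 - 1))
         by (rewrite ew; field; lra).
       exact hw. }
  generalize (exp (- z x)); intros e.
  rewrite ez in *.
  field; repeat split; lra.
Qed.

(** * Monotonicity and sign of the slope *)

Lemma rtgle_weight_pos (x : R) :
  0 < x -> 0 < rtgle_weight alpha beta gamma p x.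
Proof.
  intros hx; pose proof (rtgle_arg_derive_pos x hx).
  unfold rtgle_weight, rtgle_density.
  repeat apply Rmult_lt_0_compat;
    auto using Rpower_pos, mixture_pos, exp_pos.
Qed.

Lemma rtgle_slope_antitone (x y : R) :
  1 <= gamma -> 0 < x -> x <= y ->
  rtgle_slope alpha beta gamma p y <= rtgle_slope alpha beta gamma p x.
Proof.
  intros hg hx hxy.
  pose proof (rtgle_arg_pos x hx) as hu.
  pose proof (rtgle_arg_le x y hx hxy) as huy.
  pose proof (rtgle_arg_derive_pos x hx) as hdu.
  assert (hz : Rpower (u x) gamma <= Rpower (u y) gamma)
    by (apply Rle_Rpower_l; lra).
  assert (hw : Rpower (u x) (gamma - 1) <= Rpower (u y) (gamma - 1))
    by (apply Rle_Rpower_l; lra).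
  assert (hd : alpha + beta * x <= alpha + beta * y)
    by (apply Rplus_le_compat_l, Rmult_le_compat_l; lra).
  (* Each of the three quotients has a nonnegative constant over a positive nondecreasing quantity;
     [1 <= gamma] is what gives [0 <= gamma - 1], both for the second numerator and for the growth
     of w. *)
  unfold rtgle_slope, Rdiv.
  apply Rplus_le_compat_r, Rplus_le_compat; [apply Rplus_le_compat |];
    (apply Rmult_le_compat_l; [| apply Rinv_le_contravar]).
  - easy.
  - apply Rmult_lt_0_compat; [apply Rpower_pos | now apply pow_lt].
  - apply Rmult_le_compat; [apply Rlt_le, Rpower_pos | apply pow_le; lra
      | easy | apply pow_incr; lra].
  - lra.
  - apply Rpower_pos.
  - easy.
  - apply Rmult_le_pos; lra.
  - apply mixture_pos, Rpower_pos.
  - apply Rplus_le_compat_l, Rmult_le_compat_l; lra.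
Qed.

(** Since p z <= 1 - p + p z, the third quotient is at most gamma / z. This removes [p] from the
    bound, which serves both the tail estimate and the case [beta = 0]. *)
Lemma rtgle_slope_le (x : R) :
  0 < x ->
  rtgle_slope alpha beta gamma p x
  <= beta / (Rpower (u x) (gamma - 1) * (alpha + beta * x) ^ 2)
     + (2 * gamma - 1) / Rpower (u x) gamma - gamma.
Proof.
  intros hx; pose proof (Rpower_pos (u x) gamma) as hz.
  pose proof (mixture_pos _ hz) as hq.
  assert (p * gamma / (1 - p + p * Rpower (u x) gamma)
          <= gamma / Rpower (u x) gamma).
  { apply Rle_div_l; [easy |].
    replace (gamma / Rpower (u x) gamma * (1 - p + p * Rpower (u x) gamma))
      with (p * gamma + (1 - p) * (gamma / Rpower (u x) gamma))
      by (field; lra).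
    assert (0 <= (1 - p) * (gamma / Rpower (u x) gamma)); [| lra].
    apply Rmult_le_pos; [lra | apply Rlt_le, Rdiv_lt_0_compat; lra]. }
  unfold rtgle_slope.
  replace ((2 * gamma - 1) / Rpower (u x) gamma)
    with ((gamma - 1) / Rpower (u x) gamma + gamma / Rpower (u x) gamma)
    by (field; lra).
  lra.
Qed.

(* [u'^2 = alpha^2 + 2 beta u] bounds the first term of the slope by
   [1 / (2 z)]. *)
Lemma rtgle_slope_neg (x : R) :
  0 < x -> 2 <= Rpower (u x) gamma -> rtgle_slope alpha beta gamma p x < 0.
Proof.
  intros hx hz.
  eapply Rle_lt_trans; [now apply rtgle_slope_le |].
  pose proof (rtgle_arg_pos x hx) as hu.
  pose proof (rtgle_arg_derive_pos x hx) as hdu.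
  pose proof (Rpower_pos (u x) (gamma - 1)) as hw.
  assert (ez : Rpower (u x) gamma = u x * Rpower (u x) (gamma - 1))
    by now apply Rpower_pred.
  assert (h1 : beta / (Rpower (u x) (gamma - 1) * (alpha + beta * x) ^ 2)
               <= / 2 / Rpower (u x) gamma).
  { apply Rle_div_l;
      [apply Rmult_lt_0_compat; [easy | now apply pow_lt] |].
    replace (/ 2 / Rpower (u x) gamma
             * (Rpower (u x) (gamma - 1) * (alpha + beta * x) ^ 2))
      with (beta + alpha ^ 2 / (2 * u x)).
    - assert (0 <= alpha ^ 2 / (2 * u x)); [| lra].
      apply Rdiv_le_0_compat; [apply pow_le |]; lra.
    - rewrite ez.
      replace ((alpha + beta * x) ^ 2) with (alpha ^ 2 + 2 * beta * u x)
        by (unfold rtgle_arg; field).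
      field; lra. }
  assert (h2 : / 2 / Rpower (u x) gamma + (2 * gamma - 1) / Rpower (u x) gamma
               < gamma); [| lra].
  replace (/ 2 / Rpower (u x) gamma + (2 * gamma - 1) / Rpower (u x) gamma)
    with ((2 * gamma - / 2) / Rpower (u x) gamma) by (field; lra).
  (* As z >= 2, one has 2 gamma - 1/2 < 2 gamma <= gamma z. *)
  apply Rlt_div_l; [lra |].
  assert (gamma * 2 <= gamma * Rpower (u x) gamma)
    by (apply Rmult_le_compat_l; lra).
  lra.
Qed.

Lemma rtgle_arg_ge_2 : exists x, 0 < x /\ 2 <= u x.
Proof.
  destruct alpha_or_beta_pos as [h | h].
  - assert (hx : 0 < 2 / alpha) by (apply Rdiv_lt_0_compat; lra).
    exists (2 / alpha); split; [easy |].
    unfold rtgle_arg; replace (alpha * (2 / alpha)) with 2 by (field; lra).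
    assert (0 <= beta * (2 / alpha) ^ 2)
      by (apply Rmult_le_pos; [| apply pow_le]; lra).
    lra.
  - assert (hx : 0 < 2 / beta) by (apply Rdiv_lt_0_compat; lra).
    (* This witness is rational in [beta], avoiding a square root, and makes the quadratic term
       already exceed 4. *)
    exists (2 + 2 / beta); split; [lra |].
    unfold rtgle_arg.
    replace (beta * (2 + 2 / beta) ^ 2 / 2)
      with (4 + 2 * beta + 2 / beta) by (field; lra).
    assert (0 <= alpha * (2 + 2 / beta)) by (apply Rmult_le_pos; lra).
    lra.
Qed.

(** * The shape of the density *)

Lemma unimodal_rtgle_density :
  1 <= gamma -> unimodal (rtgle_density alpha beta gamma p).
Proof.
  intros hg; destruct rtgle_arg_ge_2 as [X [hX hu]].
  eapply unimodal_of_derive with (X := X).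
  - exact is_derive_rtgle_density.
  - intros x hx; now apply Rlt_le, rtgle_weight_pos.
  - intros x y hx hxy; now apply rtgle_slope_antitone.
  - easy.
  - apply rtgle_slope_neg; [easy |].
    apply Rle_trans with (1 := hu).
    (* With base u >= 2 and [1 <= gamma], u = u^1 <= u^gamma, so the bound 2 passes from u to z. *)
    rewrite <- (Rpower_1 (u X)) at 1 by lra.
    apply Rle_Rpower; lra.
Qed.

Lemma decreasing_rtgle_density :
  gamma < 1 / 2 -> beta = 0 ->
  decreasing_on_pos (rtgle_density alpha beta gamma p).
Proof.
  intros hg hb; eapply decreasing_on_pos_of_derive.
  - exact is_derive_rtgle_density.
  - exact rtgle_weight_pos.
  - intros x hx; eapply Rle_lt_trans; [now apply rtgle_slope_le |].
    rewrite hb at 1; unfold Rdiv at 1; rewrite Rmult_0_l.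
    assert (0 < (1 - 2 * gamma) / Rpower (u x) gamma)
      by (apply Rdiv_lt_0_compat; [lra | apply Rpower_pos]).
    replace ((2 * gamma - 1) / Rpower (u x) gamma)
      with (- ((1 - 2 * gamma) / Rpower (u x) gamma))
      by (field; apply Rgt_not_eq, Rpower_pos).
    lra.
Qed.

End RTGLE.

(** Differentiability accompanies the formula, so that the value of [Derive] is a genuine
    derivative. The shape results transfer from the closed form because they compare values at
    positive points only. *)
Theorem theorem1 (alpha beta gamma p : R)
    (halpha : 0 <= alpha) (hbeta : 0 <= beta)
    (hab : (alpha, beta) <> (0, 0))
    (hgamma : 0 < gamma) (hp : 0 <= p <= 1) :
  (forall x : R, 0 < x ->
     ex_derive (rtgle_cdf alpha beta gamma p) x /\
     rtgle_pdf alpha beta gamma p x =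
       gamma * (alpha + beta * x)
       * Rpower (alpha * x + beta * x ^ 2 / 2) (gamma - 1)
       * (1 - p + p * Rpower (alpha * x + beta * x ^ 2 / 2) gamma)
       * exp (- Rpower (alpha * x + beta * x ^ 2 / 2) gamma)) /\
  (1 <= gamma -> unimodal (rtgle_pdf alpha beta gamma p)) /\
  (gamma < 1 / 2 -> beta = 0 ->
     decreasing_on_pos (rtgle_pdf alpha beta gamma p)).
Proof.
  split; [| split].
  - intros x hx; split.
    + eexists; now apply is_derive_rtgle_cdf.
    + now apply rtgle_pdfE.
  - intros hg.
    destruct (unimodal_rtgle_density alpha beta gamma p) as [m [hm [h1 h2]]];
      try easy.
    exists m; split; [easy | split].
    + intros x y hx hxy hym; rewrite !rtgle_pdfE by (easy || lra).
      now apply h1.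
    + intros x y hx hxy; rewrite !rtgle_pdfE by (easy || lra).
      now apply h2.
  - intros hg hb x y hx hxy; rewrite !rtgle_pdfE by (easy || lra).
    now apply decreasing_rtgle_density.
Qed.
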